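(* For $\beta\in\mathbb{C}$ let $$\phi^{(1,\beta)}(e^{i\theta})=t_{\beta-1/2}(e^{i\theta})\,t_{\beta+1/2}(e^{i(\theta-\pi)}),\qquad \phi^{(2,\beta)}(e^{i\theta})=t_{\beta}(e^{i\theta})\,t_{\beta}(e^{i(\theta-\pi)}),$$ $$\phi^{(3,\beta)}(e^{i\theta})=t_{\beta-1/2}(e^{i(\theta+\pi/2)})\,t_{\beta+1/2}(e^{i(\theta-\pi/2)}),\qquad \phi^{(4,\beta)}(e^{i\theta})=t_{\beta}(e^{i(\theta+\pi/2)})\,t_{\beta}(e^{i(\theta-\pi/2)}).$$ Then for every $n\geq 1$ $$\det M_n(\phi^{(3,\beta)})=i^{\sigma}\det M_n(\phi^{(1,\beta)}),\qquad \det M_n(\phi^{(4,\beta)})=\det M_n(\phi^{(2,\beta)}),$$ where $\sigma=0$ if $n$ is even and $\sigma=1$ if $n$ is odd.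
   Context: $\phi_k=\frac1{2\pi}\int_0^{2\pi}\phi(e^{i\theta})e^{-ik\theta}d\theta$ is the $k$-th Fourier coefficient, and $M_n(\phi)=(\phi_{j-k}+\phi_{j+k+1})_{j,k=0}^{n-1}$. For $\beta\in\mathbb{C}$, $t_\beta(e^{i\theta})=\exp(i\beta(\theta-\pi))$ for $0<\theta<2\pi$; $t_\beta(e^{i(\theta-\theta_0)})$ is the value of $t_\beta$ at the point $e^{i(\theta-\theta_0)}$ of the unit circle. *)

(* Defs.v *)
From mathcomp Require Import all_boot all_order all_algebra.
From mathcomp Require Import all_classical all_reals all_analysis.
From mathcomp Require Import complex.

Set Implicit Arguments.
Unset Strict Implicit.
Unset Printing Implicit Defensive.
Import Order.TTheory GRing.Theory Num.Theory.
Import numFieldNormedType.Exports.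
Local Open Scope classical_set_scope.
Local Open Scope ring_scope.
Local Open Scope complex_scope.

Definition cexp {R : realType} (z : R[i]) : R[i] :=
  (expR (complex.Re z) * cos (complex.Im z)) +i*
  (expR (complex.Re z) * sin (complex.Im z)).

Definition cis {R : realType} (theta : R) : R[i] := cexp ('i%C * theta%:C).

Definition cintegral {R : realType} (a b : R) (f : R -> R[i]) : R[i] :=
  (\int[lebesgue_measure]_(x in `[a, b]) complex.Re (f x))%R +i*
  (\int[lebesgue_measure]_(x in `[a, b]) complex.Im (f x))%R.

(* A symbol is a function on the complex plane of which only the values on the
   unit circle are used. *)
Definition fourier_coef {R : realType} (phi : R[i] -> R[i]) (k : int) : R[i] :=
  ((2 * pi)^-1)%:C *
  cintegral 0 (2 * pi) (fun theta => phi (cis theta) * cis (- (k%:~R * theta))).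

Definition toeplitz_hankel {R : realType} (n : nat) (phi : R[i] -> R[i]) :
    'M[R[i]]_n :=
  \matrix_(j < n, k < n)
    (fourier_coef phi ((j : nat)%:Z - (k : nat)%:Z) +
     fourier_coef phi (j + k + 1)%N%:Z).

(* The argument of a point of the unit circle, taken in [0, 2 pi). *)
Definition circle_arg {R : realType} (z : R[i]) : R :=
  xget 0 [set theta | 0 <= theta < 2 * pi /\ cis theta = z].

(* The function t_beta is specified for 0 < theta < 2 pi only.  Its value at the
   point 1, here e^(-i beta pi), does not affect Fourier coefficients. *)
Definition tsym {R : realType} (beta z : R[i]) : R[i] :=
  cexp ('i%C * beta * (circle_arg z - pi)%:C).

(* [tsym_at beta theta0] is e^(i theta) |-> t_beta (e^(i (theta - theta0))). *)
Definition tsym_at {R : realType} (beta : R[i]) (theta0 : R) (z : R[i]) : R[i] :=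
  tsym beta (z * cis (- theta0)).

Definition phi1 {R : realType} (beta z : R[i]) : R[i] :=
  tsym (beta - 2^-1) z * tsym_at (beta + 2^-1) pi z.

Definition phi2 {R : realType} (beta z : R[i]) : R[i] :=
  tsym beta z * tsym_at beta pi z.

Definition phi3 {R : realType} (beta z : R[i]) : R[i] :=
  tsym_at (beta - 2^-1) (- (pi / 2)) z * tsym_at (beta + 2^-1) (pi / 2) z.

Definition phi4 {R : realType} (beta z : R[i]) : R[i] :=
  tsym_at beta (- (pi / 2)) z * tsym_at beta (pi / 2) z.

(* Main.v *)
Require Import Defs.
From mathcomp Require Import all_boot all_order all_algebra.
From mathcomp Require Import all_classical all_reals all_analysis.
From mathcomp Require Import measurable_realfun.
From mathcomp Require Import complex ring lra.
Local Open Scope ring_scope.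
Local Open Scope complex_scope.

(** The symbols [phi3] and [phi4] are [phi1] and [phi2] rotated by a quarter
    turn, so their [k]-th Fourier coefficients are those of [phi1] and [phi2]
    times ['i ^ k] ([fourier_coef_rot]).  Beyond this, the theorem rests on the
    parity of the symbols.  The function [phi2] is even, because the half turn
    exchanges its two factors; so its odd coefficients vanish.  On the circle
    [t_(beta + 1) (z) = - z t_beta (z)], so [phi1] with parameter [beta] is [z]
    times [phi2] with parameter [beta - 1/2]; hence [phi1] is odd and its even
    coefficients vanish.

    Now [j - k] and [j + k + 1] have opposite parities.  Every entry of the
    matrix of [phi1] or [phi2] is therefore one single coefficient, and passing
    to the rotated symbol multiplies this entry by a power of ['i]: by
    ['i ^ (j - k)] or by ['i ^ (j + k + 1)], according to the parity of [j + k].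
    For each of the two symbols this factor is a product of a factor depending
    on [j] and one depending on [k]: [(-1) ^ uphalf j] and [(-1) ^ uphalf k] for
    [phi2] ([toeplitz_hankel_even]), [(-1) ^ (j./2)] and ['i * (-1) ^ uphalf k]
    for [phi1] ([toeplitz_hankel_odd]).  So the determinants differ by the
    product over [j] of the two factors at [j].  It is [1] for [phi2]; for [phi1]
    it is the product of the numbers ['i * (-1) ^ j], where consecutive pairs
    cancel.

    The analytic content is that the integral of a bounded measurable periodic
    function over a period is invariant under translation
    ([cintegral_periodic]), and that the symbols are bounded and measurable. *)

Import Order.TTheory GRing.Theory Num.Theory.
Import numFieldNormedType.Exports.
Local Open Scope classical_set_scope.
Set Implicit Arguments.
Unset Strict Implicit.
Unset Printing Implicit Defensive.

(** * The circle and its argument *)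

Lemma cexpD (R : realType) (z w : R[i]) : cexp (z + w) = cexp z * cexp w.
Proof.
case: z w => [a b] [c d]; rewrite /cexp /= expRD cosD sinD.
by apply/eqP; rewrite eq_complex /=; apply/andP; split; apply/eqP; ring.
Qed.

Lemma cisE (R : realType) (x : R) : cis x = cos x +i* sin x.
Proof.
by rewrite /cis /cexp /= !mul0r !mul1r subr0 add0r expR0 !mul1r.
Qed.

Lemma cisD (R : realType) (x y : R) : cis (x + y) = cis x * cis y.
Proof. by rewrite /cis rmorphD mulrDr cexpD. Qed.

Lemma cis0 (R : realType) : cis (0 : R) = 1.
Proof. by rewrite cisE cos0 sin0. Qed.

Lemma cis_pi (R : realType) : cis (pi : R) = -1.
Proof.
by rewrite cisE cospi sinpi; apply/eqP; rewrite eq_complex /= oppr0 !eqxx.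
Qed.

Lemma cisN_pi (R : realType) : cis (- pi : R) = -1.
Proof.
rewrite cisE cosN sinN cospi sinpi; apply/eqP.
by rewrite eq_complex /= !oppr0 !eqxx.
Qed.

Lemma cis_pihalf (R : realType) : cis (pi / 2 : R) = 'i.
Proof. by rewrite cisE cos_pihalf sin_pihalf. Qed.

Lemma cis_periodic (R : realType) (x : R) : cis (x + 2 * pi) = cis x.
Proof.
by rewrite mulr_natl mulr2n addrA cisD (cisD x) cis_pi !mulrN1 opprK.
Qed.

Lemma cis_2pi (R : realType) : cis (2 * pi : R) = 1.
Proof. by rewrite -[2 * pi]add0r cis_periodic cis0. Qed.

Lemma cis_int (R : realType) (x : R) (m : int) : cis (x * m%:~R) = cis x ^ m.
Proof.
have nat_case (y : R) n : cis (y * n%:R) = cis y ^+ n.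
  elim: n => [|n IHn]; first by rewrite mulr0 cis0 expr0.
  by rewrite -natr1 mulrDr mulr1 cisD IHn exprSr.
have cisV (y : R) : cis (- y) = (cis y)^-1.
  have e : cis y * cis (- y) = 1 by rewrite -cisD subrr cis0.
  have u : cis y != 0.
    by apply: contra_eq_neq e => ->; rewrite mul0r eq_sym oner_eq0.
  by apply: (mulfI u); rewrite divff.
case: m => n; first by rewrite nat_case.
by rewrite NegzE mulrNz mulrN cisV nat_case -exprnN.
Qed.

Lemma cis_inj (R : realType) (x y : R) :
  0 <= x < 2 * pi -> 0 <= y < 2 * pi -> cis x = cis y -> x = y.
Proof.
wlog le_xy : x y / x <= y.
  by move=> H hx hy e; case: (leP x y) => [/H|/ltW/H h]; [exact|apply/esym/h].
move=> hx hy e; apply/eqP; rewrite eq_le le_xy /= leNgt; apply/negP => lt_xy.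
(* [cos (2 d) = 1 - 2 sin^2 d = 1] forces [sin d = 0], while [0 < d < pi]. *)
pose d := (y - x) / 2.
have : 0 < sin d.
  apply: sin_gt0_pi; rewrite /d; lra.
have : cos (d *+ 2) = 1.
  have -> : d *+ 2 = y - x by rewrite /d -mulr_natr mulfVK.
  have := e; rewrite !cisE => -[ec es].
  by rewrite cosB -ec -es -!expr2 cos2Dsin2.
rewrite cos_mulr2n cos2sin2 => e1 spos.
have : sin d ^+ 2 = 0 by move: e1; rewrite mulr2n; lra.
by move/eqP; rewrite sqrf_eq0 (gt_eqF spos).
Qed.

(** The floor makes the argument visibly a measurable function of the angle,
    with no distinction of arcs. *)
Lemma circle_arg_cis (R : realType) (x : R) :
  circle_arg (cis x) = x - (2 * pi) * (Num.floor (x / (2 * pi)))%:~R.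
Proof.
have pi2_gt0 : 0 < 2 * pi :> R by rewrite mulr_gt0 ?pi_gt0.
set y := RHS.
have y_itv : 0 <= y < 2 * pi.
  have /andP[lo hi] := floor_itv (x / (2 * pi)).
  move: lo hi; rewrite ler_pdivlMr // ltr_pdivrMr // rmorphD /= => lo hi.
  by apply/andP; rewrite /y; split; lra.
have cis_y : cis y = cis x.
  rewrite /y cisD -mulrN -rmorphN /=.
  by rewrite cis_int cis_2pi exp1rz mulr1.
rewrite /circle_arg; case: xgetP => [t -> [t_itv t_eq]|none].
  by apply: cis_inj => //; rewrite cis_y.
by have := none y; case; split.
Qed.

Lemma cis_circle_arg (R : realType) (x : R) : cis (circle_arg (cis x)) = cis x.
Proof.
rewrite circle_arg_cis cisD -mulrN -rmorphN /= cis_int.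
by rewrite cis_2pi exp1rz mulr1.
Qed.

Lemma circle_arg_itv (R : realType) (x : R) : 0 <= circle_arg (cis x) < 2 * pi.
Proof.
rewrite /circle_arg; case: xgetP => [t -> []//|_].
by rewrite lexx mulr_gt0 ?pi_gt0.
Qed.

(** * Integrals of periodic functions *)

Local Notation mu := lebesgue_measure.

Lemma measurable_translation (R : realType) (a : R) :
  measurable_fun [set: R] (fun x : R => x + a).
Proof. exact: (@measurable_funD _ _ R setT id (cst a)). Qed.

(** A translation maps half-open intervals to half-open intervals of the same
    length, and these determine Lebesgue measure. *)
Lemma lebesgue_measure_translation (R : realType) (a : R) (A : set R) :
  measurable A ->
  pushforward mu ((fun x => x + a) : _ -> measurableTypeR R) A = mu A.
Proof.
move=> mA; apply/esym/lebesgue_measure_unique => //=.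
  exact: measurable_translation.
move=> _ _ [[c d]] _ <-; rewrite /pushforward.
have -> : (fun x => x + a) @^-1` `]c, d] = `]c - a, d - a]%classic.
  by apply/seteqP; split => x /=; rewrite !in_itv /= ltrBlDr lerBrDr.
by rewrite !lebesgue_measure_itv /= !lte_fin ltrD2r -!EFinB opprB addrA subrK.
Qed.

(** These functions are closed under products and translations, and integrable
    on all compact intervals; so the jumps of the symbols need not be tracked. *)
Definition bddmeas (R : realType) (f : R -> R) :=
  measurable_fun setT f /\ exists M, forall x, `|f x| <= M.

Lemma bddmeas_integrable (R : realType) (f : R -> R) (c d : R) :
  bddmeas f -> mu.-integrable `[c, d] (EFin \o f).
Proof.
move=> [mf [M fM]]; apply: measurable_bounded_integrable => //.
- by rewrite /= lebesgue_measure_itv /=; case: ifP => //; rewrite -EFinB ltry.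
- exact: measurable_funTS.
- exists M; split; first exact: num_real.
  by move=> N MN x _; exact: le_trans (fM x) (ltW MN).
Qed.

Lemma bddmeasD (R : realType) (f g : R -> R) : bddmeas f -> bddmeas g ->
  bddmeas (fun x => f x + g x).
Proof.
move=> [mf [M fM]] [mg [N gN]]; split; first exact: measurable_funD.
by exists (M + N) => x; rewrite (le_trans (ler_normD _ _)) ?lerD.
Qed.

Lemma bddmeasN (R : realType) (f : R -> R) :
  bddmeas f -> bddmeas (fun x => - f x).
Proof.
move=> [mf [M fM]]; split; first exact: measurable_funN.
by exists M => x; rewrite normrN.
Qed.

Lemma bddmeasM (R : realType) (f g : R -> R) : bddmeas f -> bddmeas g ->
  bddmeas (fun x => f x * g x).
Proof.
move=> [mf [M fM]] [mg [N gN]]; split; first exact: measurable_funM.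
by exists (M * N) => x; rewrite normrM ler_pM.
Qed.

Lemma bddmeas_translate (R : realType) (f : R -> R) (a : R) :
  bddmeas f -> bddmeas (fun x => f (x + a)).
Proof.
move=> [mf [M fM]]; split; last by exists M.
exact: (measurableT_comp mf (measurable_translation a)).
Qed.

Lemma Rintegral_translate (R : realType) (f : R -> R) (a c d : R) : bddmeas f ->
  (\int[mu]_(x in `[c, d]) f (x + a))%R =
  (\int[mu]_(x in `[c + a, d + a]) f x)%R.
Proof.
move=> bf; have [mf _] := bf; congr fine.
have pre : `[c, d]%classic =
    ((fun x => x + a) : _ -> measurableTypeR R) @^-1` `[c + a, d + a].
  by apply/seteqP; split => x /=; rewrite !in_itv /= !lerD2r.
rewrite pre -(@integral_pushforward _ _ _ _ _
   ((fun x => x + a) : measurableTypeR R -> measurableTypeR R)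
   _ mu _ (EFin \o f)) //=.
- apply: eq_measure_integral => [|mt A mA _] /=.
    exact: measurable_translation.
  exact: lebesgue_measure_translation.
- exact: measurable_translation.
- exact/measurable_EFinP.
- by rewrite -pre; exact: (bddmeas_integrable _ _ (bddmeas_translate a bf)).
Qed.

Lemma Rintegral_cat (R : realType) (f : R -> R) (a b c : R) : bddmeas f ->
  a <= b -> b <= c ->
  (\int[mu]_(x in `[a, c]) f x)%R =
  (\int[mu]_(x in `[a, b]) f x)%R + (\int[mu]_(x in `[b, c]) f x)%R.
Proof.
move=> bf ab bc.
have := @Rintegral_itvB _ f (BLeft a) (BRight c) b
  (bddmeas_integrable a c bf) ab bc.
move/eqP; rewrite subr_eq => /eqP ->; rewrite addrC; congr (_ + _).
apply: Rintegral_itv_obnd_cbnd.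
apply: integrableS (bddmeas_integrable b c bf) => //.
by apply: subset_itvr; rewrite bnd_simp.
Qed.

(** The part of the shifted period that sticks out beyond [p] is the translate
    by [p] of the part missing at the start. *)
Lemma Rintegral_periodic (R : realType) (f : R -> R) (p a : R) : bddmeas f ->
  periodic f p -> 0 <= a <= p ->
  (\int[mu]_(x in `[0, p]) f (x + a))%R = (\int[mu]_(x in `[0, p]) f x)%R.
Proof.
move=> bf fp /andP[a0 ap].
rewrite Rintegral_translate // add0r.
rewrite (@Rintegral_cat _ f a p) //; last by rewrite lerDl.
rewrite (@Rintegral_cat _ f 0 a p) // addrC; congr (_ + _).
have := @Rintegral_translate _ f p 0 a bf; rewrite add0r addrC => <-.
by apply: eq_Rintegral => x _; rewrite fp.
Qed.

Definition bddmeasC (R : realType) (f : R -> R[i]) :=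
  bddmeas (fun x => complex.Re (f x)) /\ bddmeas (fun x => complex.Im (f x)).

Lemma bddmeasCM (R : realType) (f g : R -> R[i]) :
  bddmeasC f -> bddmeasC g -> bddmeasC (fun x => f x * g x).
Proof.
move=> [rf jf] [rg jg].
have -> : (fun x => f x * g x) = (fun x =>
    (complex.Re (f x) * complex.Re (g x) - complex.Im (f x) * complex.Im (g x))
    +i*
    (complex.Re (f x) * complex.Im (g x) + complex.Im (f x) * complex.Re (g x))).
  by apply/funext => x; case: (f x) (g x) => [? ?] [? ?].
by split; apply: bddmeasD; rewrite /=; do ?apply: bddmeasN; apply: bddmeasM.
Qed.

Lemma cintegralZl (R : realType) (f : R -> R[i]) (c d : R) (z : R[i]) :
  bddmeasC f -> cintegral c d (fun x => z * f x) = z * cintegral c d f.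
Proof.
move=> [rf jf].
have iZ g (t : R) : bddmeas g ->
    mu.-integrable `[c, d] (EFin \o (fun x => t * g x)).
  move=> bg; apply: bddmeas_integrable; apply: bddmeasM => //.
  by split => //; exists `|t|.
have Z g (t : R) : bddmeas g ->
    (\int[mu]_(x in `[c, d]) (t * g x))%R =
    t * (\int[mu]_(x in `[c, d]) g x)%R.
  by move=> bg; apply: RintegralZl => //; exact: bddmeas_integrable.
case: z => [u v]; rewrite /cintegral /=.
transitivity (
  (\int[mu]_(x in `[c, d]) (u * complex.Re (f x) - v * complex.Im (f x)))%R +i*
  (\int[mu]_(x in `[c, d]) (u * complex.Im (f x) + v * complex.Re (f x)))%R).
  by congr (_ +i* _); apply: eq_Rintegral => x _; case: (f x).
by rewrite RintegralB ?RintegralD ?Z //; exact: iZ.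
Qed.

Lemma cintegral_periodic (R : realType) (f : R -> R[i]) (p a : R) :
  bddmeasC f -> periodic f p -> 0 <= a <= p ->
  cintegral 0 p (fun x => f (x + a)) = cintegral 0 p f.
Proof.
move=> [rf jf] fp ap; rewrite /cintegral.
congr (_ +i* _).
  by apply: (Rintegral_periodic rf _ ap) => x; rewrite fp.
by apply: (Rintegral_periodic jf _ ap) => x; rewrite fp.
Qed.

Lemma bddmeasC_cexp (R : realType) (u v : R -> R) :
  measurable_fun setT u -> measurable_fun setT v ->
  (exists M, forall x, u x <= M) -> bddmeasC (fun x => cexp (u x +i* v x)).
Proof.
move=> u_meas v_meas [M uM].
have be : bddmeas (expR \o u).
  split; first exact: measurableT_comp.
  by exists (expR M) => x /=; rewrite ger0_norm ?expR_ge0 // ler_expR.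
have mc : measurable_fun setT (@cos R).
  by apply: continuous_measurable_fun; exact: continuous_cos.
have ms : measurable_fun setT (@sin R).
  by apply: continuous_measurable_fun; exact: continuous_sin.
split; apply: (bddmeasM be); split.
- exact: measurableT_comp mc v_meas.
- by exists 1 => x; exact: cos_max.
- exact: measurableT_comp ms v_meas.
- by exists 1 => x; exact: sin_max.
Qed.

Lemma measurable_circle_arg_cis (R : realType) :
  measurable_fun setT (fun x : R => circle_arg (cis x)).
Proof.
under eq_fun do rewrite circle_arg_cis.
have pi2_gt0 : 0 < 2 * pi :> R by rewrite mulr_gt0 ?pi_gt0.
apply: measurable_funB => //; apply: measurable_funM => //.
apply: nondecreasing_measurable => // x y xy.
by rewrite ler_int le_floor // ler_pM2r ?invr_gt0.
Qed.

Lemma bddmeasC_tsym (R : realType) (beta : R[i]) :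
  bddmeasC (fun x : R => tsym beta (cis x)).
Proof.
case: beta => [b c].
have -> : (fun x : R => tsym (b +i* c) (cis x)) =
    (fun x => cexp ((- c * (circle_arg (cis x) - pi)) +i*
                    (b * (circle_arg (cis x) - pi)))).
  apply/funext => x; rewrite /tsym; congr cexp.
  by apply/eqP; rewrite eq_complex /=; apply/andP; split; apply/eqP; ring.
have ms : measurable_fun setT (fun x : R => circle_arg (cis x) - pi).
  by apply: measurable_funB => //; exact: measurable_circle_arg_cis.
apply: bddmeasC_cexp; [exact: measurable_funM|exact: measurable_funM|].
exists (`|c| * pi) => x; rewrite (le_trans (ler_norm _)) // normrM normrN.
rewrite ler_wpM2l // ler_norml.
have := circle_arg_itv x => /andP[h0 h1]; apply/andP; split; lra.
Qed.

Lemma bddmeasC_cis_comp (R : realType) (g : R -> R) :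
  measurable_fun setT g -> bddmeasC (fun x => cis (g x)).
Proof.
move=> mg.
have -> : (fun x => cis (g x)) = (fun x => cexp (0 +i* g x)).
  apply/funext => x; rewrite /cis; congr cexp.
  by apply/eqP; rewrite eq_complex /= !mul0r mulr0 mul1r subr0 add0r !eqxx.
by apply: bddmeasC_cexp => //; exists 0.
Qed.

Lemma bddmeasC_translate (R : realType) (f : R -> R[i]) (a : R) :
  bddmeasC f -> bddmeasC (fun x => f (x + a)).
Proof.
move=> [rf jf]; split; first exact: (bddmeas_translate a rf).
exact: (bddmeas_translate a jf).
Qed.

Lemma bddmeasC_tsym_at (R : realType) (beta : R[i]) (t : R) :
  bddmeasC (fun x : R => tsym_at beta t (cis x)).
Proof.
rewrite /tsym_at; under eq_fun do rewrite -cisD.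
exact: (bddmeasC_translate (- t) (bddmeasC_tsym beta)).
Qed.

(** Substituting [x + a] for [x] in the integral over a full period moves the
    rotation from the symbol to the exponential. *)
Lemma fourier_coef_rot (R : realType) (phi psi : R[i] -> R[i]) (a : R)
    (k : int) :
  bddmeasC (fun x => phi (cis x)) -> 0 <= a <= 2 * pi ->
  (forall x, psi (cis x) = phi (cis x * cis a)) ->
  fourier_coef psi k = cis a ^ k * fourier_coef phi k.
Proof.
move=> bphi a_itv psiE; rewrite /fourier_coef mulrCA; congr (_ * _).
pose G x := phi (cis x) * cis (- (k%:~R * x)).
have bG : bddmeasC G.
  apply: bddmeasCM => //; apply: bddmeasC_cis_comp.
  by apply: measurable_funN; apply: measurable_funM.
rewrite -/G -(@cintegral_periodic _ G (2 * pi) a) //; last first.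
  move=> x; rewrite /G cis_periodic mulrDr opprD cisD.
  have -> : cis (- (k%:~R * (2 * pi))) = 1 :> R[i].
    by rewrite -mulNr -rmorphN mulrC cis_int cis_2pi exp1rz.
  by rewrite mulr1.
rewrite -cintegralZl; last exact: bddmeasC_translate.
congr cintegral; apply/funext => x; rewrite /G psiE cisD mulrCA; congr (_ * _).
rewrite -cis_int -cisD; congr cis; ring.
Qed.

(** * Symmetries of the four symbols *)

(** On the circle [t_1 (z) = exp (i (arg z - pi)) = - z]. *)
Lemma tsym_succ (R : realType) (gamma : R[i]) (x : R) :
  tsym (gamma + 1) (cis x) = - cis x * tsym gamma (cis x).
Proof.
rewrite /tsym mulrDr mulr1 mulrDl cexpD mulrC; congr (_ * _).
by rewrite -/(cis _) cisD cis_circle_arg cisN_pi mulrN1.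
Qed.

(** The half-integer shifts of the two parameters differ by one, and [t_1]
    contributes the factor [- (- z) = z].  Hence the coefficients of [phi1] are
    those of a [phi2] with index lowered by one. *)
Lemma phi1_phi2 (R : realType) (beta : R[i]) (x : R) :
  phi1 beta (cis x) = cis x * phi2 (beta - 2^-1) (cis x).
Proof.
have -> : beta = beta - 2^-1 + 2^-1 by rewrite subrK.
set g := beta - 2^-1; rewrite /phi1 /phi2 addrK.
have -> : g + 2^-1 + 2^-1 = g + 1.
  by rewrite -addrA -[2^-1 + _]mulr2n -(mulr_natr 2^-1) mulVf // pnatr_eq0.
by rewrite /tsym_at -cisD tsym_succ cisD cisN_pi mulrN1 opprK mulrCA.
Qed.

(** The half turn exchanges the two factors of [phi2]. *)
Lemma phi2_even (R : realType) (beta : R[i]) (x : R) :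
  phi2 beta (cis x) = phi2 beta (cis x * cis pi).
Proof.
rewrite /phi2 /tsym_at cis_pi cisN_pi.
by rewrite [in RHS]mulrAC !mulrN1 opprK mulrC.
Qed.

Lemma phi3_rot (R : realType) (beta : R[i]) (x : R) :
  phi3 beta (cis x) = phi1 beta (cis x * cis (pi / 2)).
Proof.
rewrite /phi3 /phi1 /tsym_at opprK -!mulrA -[cis (pi / 2) * _]cisD.
by congr (_ * tsym _ (_ * cis _)); field.
Qed.

Lemma phi4_rot (R : realType) (beta : R[i]) (x : R) :
  phi4 beta (cis x) = phi2 beta (cis x * cis (pi / 2)).
Proof.
rewrite /phi4 /phi2 /tsym_at opprK -!mulrA -[cis (pi / 2) * _]cisD.
by congr (_ * tsym _ (_ * cis _)); field.
Qed.

Lemma bddmeasC_phi1 (R : realType) (beta : R[i]) :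
  bddmeasC (fun x : R => phi1 beta (cis x)).
Proof. exact: bddmeasCM (bddmeasC_tsym _) (bddmeasC_tsym_at _ _). Qed.

Lemma bddmeasC_phi2 (R : realType) (beta : R[i]) :
  bddmeasC (fun x : R => phi2 beta (cis x)).
Proof. exact: bddmeasCM (bddmeasC_tsym _) (bddmeasC_tsym_at _ _). Qed.

Lemma pihalf_itv (R : realType) : 0 <= (pi : R) / 2 <= 2 * pi.
Proof. have := pi_gt0 R; lra. Qed.

Lemma pi_itv (R : realType) : 0 <= (pi : R) <= 2 * pi.
Proof. have := pi_gt0 R; lra. Qed.

Lemma fourier_coef_phi3 (R : realType) (beta : R[i]) (k : int) :
  fourier_coef (phi3 beta) k = 'i ^ k * fourier_coef (phi1 beta) k.
Proof.
rewrite (fourier_coef_rot k (bddmeasC_phi1 beta) (pihalf_itv R)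
  (phi3_rot beta)).
by rewrite cis_pihalf.
Qed.

Lemma fourier_coef_phi4 (R : realType) (beta : R[i]) (k : int) :
  fourier_coef (phi4 beta) k = 'i ^ k * fourier_coef (phi2 beta) k.
Proof.
rewrite (fourier_coef_rot k (bddmeasC_phi2 beta) (pihalf_itv R)
  (phi4_rot beta)).
by rewrite cis_pihalf.
Qed.

Lemma fourier_coef_phi1 (R : realType) (beta : R[i]) (k : int) :
  fourier_coef (phi1 beta) k = fourier_coef (phi2 (beta - 2^-1)) (k - 1).
Proof.
rewrite /fourier_coef; congr (_ * cintegral _ _ _); apply/funext => x.
rewrite phi1_phi2 -mulrA mulrCA; congr (_ * _).
by rewrite -cisD; congr cis; rewrite rmorphB /=; ring.
Qed.

(** By evenness the half turn fixes the symbol, while it changes the sign of an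
    odd coefficient.  Parity of the integer [k] is expressed by [(-1) ^ k], the
    factor that the half turn produces. *)
Lemma fourier_coef_phi2_odd (R : realType) (beta : R[i]) (k : int) :
  (-1) ^ k = -1 :> R[i] -> fourier_coef (phi2 beta) k = 0.
Proof.
move=> k_odd.
have := fourier_coef_rot k (bddmeasC_phi2 beta) (pi_itv R) (phi2_even beta).
rewrite cis_pi k_odd mulN1r => /eqP.
by rewrite -addr_eq0 -mulr2n mulrn_eq0 /= => /eqP.
Qed.

Lemma fourier_coef_phi1_even (R : realType) (beta : R[i]) (k : int) :
  (-1) ^ k = 1 :> R[i] -> fourier_coef (phi1 beta) k = 0.
Proof.
move=> k_even; rewrite fourier_coef_phi1 fourier_coef_phi2_odd //.
by rewrite expfzDr ?oppr_eq0 ?oner_eq0 // k_even mul1r exprN1 invrN1.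
Qed.

(** * Diagonal scaling of the matrices *)

Lemma det_scale_rows_cols (F : comPzRingType) n (A B : 'M[F]_n)
    (p q : 'I_n -> F) :
  (forall j k, A j k = p j * q k * B j k) ->
  \det A = (\prod_j (p j * q j)) * \det B.
Proof.
move=> AE; have -> : A = diag_mx (\row_j p j) *m B *m diag_mx (\row_j q j).
  by apply/matrixP => j k; rewrite mul_mx_diag mul_diag_mx !mxE AE mulrAC.
rewrite !det_mulmx !det_diag big_split /= mulrAC.
by congr (_ * _ * _); apply: eq_bigr => j _; rewrite mxE.
Qed.

Lemma i_neq0 (R : realType) : 'i != 0 :> R[i].
Proof. by rewrite eq_complex /= oner_eq0 andbF. Qed.

Lemma expi_half (R : realType) (n : nat) :
  'i ^+ n = 'i ^+ odd n * (-1) ^+ n./2 :> R[i].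
Proof. by rewrite -[in LHS](odd_double_half n) exprD -mul2n exprM sqr_i. Qed.

Lemma expi_sub (R : realType) (j k : nat) :
  'i ^ (j%:Z - k%:Z) = 'i ^+ j * (-1) ^+ odd k * 'i ^+ k :> R[i].
Proof.
rewrite expfzDr ?i_neq0 // -mulrA; congr (_ * _).
rewrite -exprnN -exprVn signr_odd -exprMn; congr (_ ^+ _).
apply: (mulfI (i_neq0 R)).
by rewrite divff ?i_neq0 // mulrCA -expr2 sqr_i mulN1r opprK.
Qed.

Lemma sign_sub (R : realType) (j k : nat) :
  (-1) ^ (j%:Z - k%:Z) = (-1) ^+ (odd j (+) odd k) :> R[i].
Proof.
rewrite expfzDr ?oppr_eq0 ?oner_eq0 // signr_addb -exprnN !signr_odd.
congr (_ * _).
by rewrite -exprVn invrN1.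
Qed.

Lemma sign_add (R : realType) (j k : nat) :
  (-1) ^ (j + k + 1)%N%:Z = - (-1) ^+ (odd j (+) odd k) :> R[i].
Proof.
by rewrite -exprnP addn1 exprS mulN1r -[(-1) ^+ (j + k)]signr_odd oddD.
Qed.

(** The common form of both cases: after the factors that depend on [j./2] and
    [k./2] only, what is left depends on the parities of [j] and [k]. *)
Lemma toeplitz_hankel_quarter_turn (R : realType) n (phi psi : R[i] -> R[i])
    (j k : 'I_n) :
  (forall m, fourier_coef psi m = 'i ^ m * fourier_coef phi m) ->
  toeplitz_hankel n psi j k =
    (-1) ^+ j./2 * (-1) ^+ k./2 * ('i ^+ odd j * 'i ^+ odd k) *
    ((-1) ^+ odd k * fourier_coef phi (j%:Z - k%:Z) +
     'i * fourier_coef phi (j + k + 1)%N).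
Proof.
move=> psiE; rewrite !mxE !psiE expi_sub -exprnP exprD expr1 exprD.
by rewrite !(expi_half _ j) !(expi_half _ k); ring.
Qed.

(** If only odd coefficients are present, each entry of the matrix is a single
    coefficient: the Toeplitz one for [j], [k] of different parity, the Hankel
    one otherwise.  The factors ['i ^ j] and ['i ^ (- k)] of the row and the
    column account for the Toeplitz entries and leave ['i ^ (2 k + 1)] on the
    Hankel ones.  Ordered by even and odd indices, what is left is the array
    [['i, 1], [1, -'i]]; it has rank one, with row factors [1, -'i] and column
    factors ['i, 1], and this is why a diagonal scaling can produce it. *)
Lemma toeplitz_hankel_odd (R : realType) n (phi psi : R[i] -> R[i])
    (j k : 'I_n) :
  (forall m, (-1) ^ m = 1 :> R[i] -> fourier_coef phi m = 0) ->
  (forall m, fourier_coef psi m = 'i ^ m * fourier_coef phi m) ->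
  toeplitz_hankel n psi j k =
    (-1) ^+ j./2 * ('i * (-1) ^+ uphalf k) * toeplitz_hankel n phi j k.
Proof.
move=> phi0 psiE; rewrite (toeplitz_hankel_quarter_turn _ _ psiE) mxE.
have ii : 'i * 'i = -1 :> R[i] by rewrite -expr2 sqr_i.
rewrite uphalf_half exprD.
have := phi0 (j%:Z - k%:Z); rewrite sign_sub.
have := phi0 (j + k + 1)%N; rewrite sign_add.
move: ((-1) ^+ j./2) ((-1) ^+ k./2) => s t.
move: (fourier_coef _ _) (fourier_coef _ _) => x y.
case: (odd j); case: (odd k); rewrite /= ?expr0 ?expr1 ?opprK => hx hy;
  rewrite ?(hx erefl) ?(hy erefl).
all: by ring: ii.
Qed.

(** Here the parities exchange their roles: the array is [[1, -'i], ['i, 1]],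
    again of rank one, with row factors [1, 'i] and column factors [1, -'i]. *)
Lemma toeplitz_hankel_even (R : realType) n (phi psi : R[i] -> R[i])
    (j k : 'I_n) :
  (forall m, (-1) ^ m = -1 :> R[i] -> fourier_coef phi m = 0) ->
  (forall m, fourier_coef psi m = 'i ^ m * fourier_coef phi m) ->
  toeplitz_hankel n psi j k =
    (-1) ^+ uphalf j * (-1) ^+ uphalf k * toeplitz_hankel n phi j k.
Proof.
move=> phi0 psiE; rewrite (toeplitz_hankel_quarter_turn _ _ psiE) mxE.
have ii : 'i * 'i = -1 :> R[i] by rewrite -expr2 sqr_i.
rewrite !uphalf_half !exprD.
have := phi0 (j%:Z - k%:Z); rewrite sign_sub.
have := phi0 (j + k + 1)%N; rewrite sign_add.
move: ((-1) ^+ j./2) ((-1) ^+ k./2) => s t.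
move: (fourier_coef _ _) (fourier_coef _ _) => x y.
case: (odd j); case: (odd k); rewrite /= ?expr0 ?expr1 ?opprK => hx hy;
  rewrite ?(hx erefl) ?(hy erefl).
all: by ring: ii.
Qed.

Lemma prod_odd_factors (R : realType) (n : nat) :
  \prod_(j < n) ((-1) ^+ j./2 * ('i * (-1) ^+ uphalf j)) = 'i ^+ odd n :> R[i].
Proof.
elim: n => [|n IHn]; first by rewrite big_ord0.
rewrite big_ord_recr /= IHn.
have -> : (-1) ^+ n./2 * ('i * (-1) ^+ uphalf n) = (-1) ^+ odd n * 'i :> R[i].
  rewrite mulrCA -exprD addnC uphalf_half -addnA addnn odd_double_half.
  by rewrite signr_odd mulrC.
have ii : 'i * 'i = -1 :> R[i] by rewrite -expr2 sqr_i.
by case: (odd n); rewrite /= ?expr0 ?expr1; ring: ii.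
Qed.

Lemma prod_even_factors (R : realType) (n : nat) :
  \prod_(j < n) ((-1) ^+ uphalf j * (-1) ^+ uphalf j) = 1 :> R[i].
Proof. by apply: big1 => j _; rewrite -expr2 sqrr_sign. Qed.

Theorem theorem7p5 (R : realType) (beta : R[i]) (n : nat) (n_ge1 : (1 <= n)%N) :
  \det (toeplitz_hankel n (phi3 beta)) =
    'i%C ^+ (if odd n then 1%N else 0%N) * \det (toeplitz_hankel n (phi1 beta))
  /\
  \det (toeplitz_hankel n (phi4 beta)) = \det (toeplitz_hankel n (phi2 beta)).
Proof.
split.
  have scaled (j k : 'I_n) := toeplitz_hankel_odd j k
    (@fourier_coef_phi1_even R beta) (fourier_coef_phi3 beta).
  by rewrite (det_scale_rows_cols scaled) prod_odd_factors; case: (odd n).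
have scaled (j k : 'I_n) := toeplitz_hankel_even j k
  (@fourier_coef_phi2_odd R beta) (fourier_coef_phi4 beta).
by rewrite (det_scale_rows_cols scaled) prod_even_factors mul1r.
Qed.
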